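(* Let $D=(d_{jl}), P=(p_{ik})\in\mathbb{R}^{n\times n}$ be coefficient matrices, let $LXY(D,P)$ be the linear relaxation of the Xia-Yuan linearization, let $LAJ(D,P)$ be the linear relaxation of the Adams-Johnson linearization, and let $LAJ(D,P)^+$ be its extended formulation in the variables $(x,y,z)$. Assume that there exist $a,b,c,d\in\{1,\dots,n\}$ with $a\ne c$, $b\ne d$ such that 1. $x_{cd}=1$ for all $x\in\operatorname{argmin}(l_{ab})$, and 2. $x_{ab}=0$ for all $x\in\operatorname{argmin}(l_{cd})$. Then $$\operatorname{Proj}_{x,z}\left(LAJ(D,P)^+\right)\subsetneq LXY(D,P).$$
   Context: All indices $i,j,k,l$ range over $\{1,\dots,n\}$. Let $LX_n$ be the set of real $n\times n$ matrices $x=(x_{ij})$ with $x_{ij}\ge 0$, $\sum_{i=1}^n x_{ij}=1$ for all $j$, and $\sum_{j=1}^n x_{ij}=1$ for all $i$. For $i,j\in\{1,\dots,n\}$ define $$u_{ij}=\max_{x}\sum_{k\ne i,\,l\ne j}p_{ik}d_{jl}x_{kl},\qquad l_{ij}=\min_{x}\sum_{k\ne i,\,l\ne j}p_{ik}d_{jl}x_{kl},$$ where max and min are over all permutation matrices $x=(x_{kl})_{k\neq i,\,l\neq j}$ of size $n-1$ (0/1 matrices with rows indexed by $\{1,\dots,n\}\setminus\{i\}$, columns by $\{1,\dots,n\}\setminus\{j\}$, and all row and column sums equal to 1). $\operatorname{argmin}(l_{ij})$ denotes the set of such permutation matrices $x$ attaining the minimum defining $l_{ij}$. $LXY(D,P)$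 is the set of $(x,z)\in\mathbb{R}^{n^2}\times\mathbb{R}^{n^2}$ with $x\in LX_n$ and, for all $i,j$, $$z_{ij}\ge l_{ij}x_{ij},\qquad z_{ij}\ge\sum_{k\neq i,\,l\neq j}p_{ik}d_{jl}x_{kl}+u_{ij}(x_{ij}-1).$$ $LAJ(D,P)$ is the set of $(x,y)$ with $x\in LX_n$ and real $y=(y_{ijkl})_{k\ne i,\,l\ne j}$ satisfying - $\sum_{i\ne k}y_{ijkl}=x_{kl}$ for all $j,k,l$ with $j\ne l$; - $\sum_{j\ne l}y_{ijkl}=x_{kl}$ for all $i,k,l$ with $i\ne k$; - $y_{ijkl}=y_{klij}$ and $y_{ijkl}\ge0$ for all $i,j,k,l$ with $k\ne i$, $l\ne j$. $LAJ(D,P)^+$ is the set of $(x,y,z)$ with $(x,y)\in LAJ(D,P)$ and $z_{ij}=\sum_{k\ne i,\,l\ne j}p_{ik}d_{jl}y_{ijkl}$ for all $i,j$. $\operatorname{Proj}_{x,z}(LAJ(D,P)^+)$ is its projection, i.e. the set of all $(x,z)$ for which some $y$ with $(x,y,z)\in LAJ(D,P)^+$ exists.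
   Formalization: The formal theorem additionally assumes p_ik d_jl ≥ 0 for all k≠i, l≠j; for arbitrary real D, P the inclusion can fail already for n=3, since with negative coefficients the second inequality of LXY(D,P) is not valid at x_ij=0. *)

(* Defs.v *)
From HB Require Import structures.
From mathcomp Require Import all_boot all_order all_algebra.
From mathcomp Require Import boolp classical_sets reals.

Set Implicit Arguments.
Unset Strict Implicit.
Unset Printing Implicit Defensive.

Import Order.TTheory GRing.Theory Num.Theory.
Local Open Scope ring_scope.
Local Open Scope classical_set_scope.

Definition LX (R : realType) (n : nat) : set 'M[R]_n :=
  [set x | [/\ forall i j, 0 <= x i j,
               forall j, \sum_i x i j = 1
             & forall i, \sum_j x i j = 1]].

(* A permutation matrix with rows indexed by 'I_n \ {i} and columns by
   'I_n \ {j} is stored as an n x n 0/1 matrix whose row i and column j, which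
   do not belong to it, are filled with zeros. *)
Definition minor_perm (n : nat) (i j : 'I_n) : {set 'M[bool]_n} :=
  [set x : 'M[bool]_n |
    [&& [forall k, forall l, (k == i) || (l == j) ==> ~~ x k l],
        [forall (k | k != i), (\sum_(l | l != j) x k l == 1)%N]
      & [forall (l | l != j), (\sum_(k | k != i) x k l == 1)%N]]]%SET.

Definition minor_cost (R : realType) (n : nat) (D P : 'M[R]_n) (i j : 'I_n)
    (x : 'M[R]_n) : R :=
  \sum_(k | k != i) \sum_(l | l != j) P i k * D j l * x k l.

Definition perm_cost (R : realType) (n : nat) (D P : 'M[R]_n) (i j : 'I_n)
    (x : 'M[bool]_n) : R :=
  minor_cost D P i j (map_mx (fun b : bool => b%:R) x).

Definition perm_costs (R : realType) (n : nat) (D P : 'M[R]_n) (i j : 'I_n) :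
    seq R :=
  [seq perm_cost D P i j x | x in minor_perm i j].

(* minor_perm i j is never empty, so the default value 0 of head is not used. *)
Definition u_bound (R : realType) (n : nat) (D P : 'M[R]_n) (i j : 'I_n) : R :=
  \big[Num.max/head 0 (perm_costs D P i j)]_(v <- perm_costs D P i j) v.

Definition l_bound (R : realType) (n : nat) (D P : 'M[R]_n) (i j : 'I_n) : R :=
  \big[Num.min/head 0 (perm_costs D P i j)]_(v <- perm_costs D P i j) v.

Definition argmin_l (R : realType) (n : nat) (D P : 'M[R]_n) (i j : 'I_n) :
    {set 'M[bool]_n} :=
  [set x in minor_perm i j | perm_cost D P i j x == l_bound D P i j]%SET.

(* The term u_bound i j * (x i j - 1) relaxes the second inequality at
   x i j = 0 as intended only when P i k * D j l >= 0 for k != i, l != j: the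
   sum over k, l then misses the entries of x in row i and in column j, and with
   negative coefficients it can exceed u_bound i j. *)
Definition LXY (R : realType) (n : nat) (D P : 'M[R]_n) :
    set ('M[R]_n * 'M[R]_n) :=
  [set xz | let: (x, z) := xz : 'M[R]_n * 'M[R]_n in
    LX x /\
    forall i j, l_bound D P i j * x i j <= z i j /\
                minor_cost D P i j x + u_bound D P i j * (x i j - 1) <= z i j].

(* y i j k l is meaningful only for k != i and l != j: the other values occur
   in no constraint. *)
Definition LAJ (R : realType) (n : nat) :
    set ('M[R]_n * ('I_n -> 'I_n -> 'I_n -> 'I_n -> R)) :=
  [set xy | let: (x, y) := xy : 'M[R]_n * _ in
    [/\ LX x,
        forall j k l, j != l -> \sum_(i | i != k) y i j k l = x k l,
        forall i k l, i != k -> \sum_(j | j != l) y i j k l = x k l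
      & forall i j k l, k != i -> l != j ->
          y i j k l = y k l i j /\ 0 <= y i j k l]].

Definition LAJ_plus (R : realType) (n : nat) (D P : 'M[R]_n) :
    set ('M[R]_n * ('I_n -> 'I_n -> 'I_n -> 'I_n -> R) * 'M[R]_n) :=
  [set xyz | let: (x, y, z) := xyz : 'M[R]_n * _ * 'M[R]_n in
    LAJ (x, y) /\
    forall i j, z i j = minor_cost D P i j (\matrix_(k, l) y i j k l)].

Definition proj_xz (R : realType) (n : nat)
    (S : set ('M[R]_n * ('I_n -> 'I_n -> 'I_n -> 'I_n -> R) * 'M[R]_n)) :
    set ('M[R]_n * 'M[R]_n) :=
  [set xz | exists y, S (xz.1, y, xz.2)].

(* Main.v *)
Require Import Defs.
From mathcomp Require Import all_boot all_order all_algebra perm.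
From mathcomp Require Import boolp classical_sets reals.
Import Order.TTheory GRing.Theory Num.Theory.
Local Open Scope ring_scope.
Local Open Scope classical_set_scope.

(** Fix [(x, y)] in [LAJ] and a pair [(i, j)].  The slice [Y] of [y] at [(i, j)]
is a matrix on the minor omitting row [i] and column [j], nonnegative, with all
line sums equal to [x i j].  By Birkhoff's theorem it is a combination of
permutation matrices of total weight [x i j], so its cost [z i j] is at least
[l_bound i j * x i j].  The difference [x - Y] is nonnegative with line sums at
most [1 - x i j]; for nonnegative coefficients its cost is at most
[u_bound i j * (1 - x i j)], because a doubly substochastic matrix lies below a
doubly stochastic one.  These two bounds are the inequalities of [LXY]
([LAJ_plus_sub_LXY]).

For strictness, let [x] be the matrix with all entries [1 / n] and let
[z i j = l_bound i j * x i j].  The point [(x, z)] is in [LXY]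
([flat_point_LXY]).  If it came from some [y], then [z a b] would be minimal, so
that the slice at [(a, b)] would combine minimizers only ([minor_cost_tight]);
all of these use the position [(c, d)], whence [y a b c d = x a b > 0].  In the
same way [y c d a b = 0], since no minimizer at [(c, d)] uses [(a, b)].  This
contradicts the symmetry of [y] ([flat_point_notin_proj]).

Birkhoff's theorem ([birkhoff]) is derived from Hall's marriage theorem
([hall_marriage]). *)

Set Implicit Arguments.
Unset Strict Implicit.
Unset Printing Implicit Defensive.

(** * Hall's marriage theorem *)

Section Hall.
(* Inside this section, names such as set0 and bigcupP refer to finite sets. *)
Import mathcomp.boot.fintype mathcomp.boot.finset.
Local Open Scope nat_scope.
Local Open Scope set_scope.

(** Halmos-Vaughan induction on the size of [A].  If some proper nonempty
[X] is tight, that is, has no more neighbours than elements, then [X] and its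
complement can be matched separately: removing the neighbours of [X] preserves
the counting condition outside [X].  If no [X] is tight, any element can be
matched with any of its neighbours, since deleting one neighbour costs each
remaining set at most the one unit it has to spare.  The value [u0] is the one
taken outside [A]. *)
Lemma hall_marriage (T U : finType) (u0 : U) (r : T -> {set U}) (A : {set T}) :
  (forall X : {set T}, X \subset A -> #|X| <= #|\bigcup_(x in X) r x|) ->
  exists2 f : T -> U, {in A &, injective f} & {in A, forall x, f x \in r x}.
Proof.
have [m] := ubnP #|A|; elim: m => // m IH in r A * => /ltnSE leAm hallA.
have [->|/set0Pn[x xA]] := eqVneq A set0.
  by exists (fun=> u0) => [x y|x]; rewrite inE.
pose tight (X : {set T}) :=
  [&& X != set0, X \proper A & #|\bigcup_(x in X) r x| <= #|X|].
have [/existsP[X /and3P[X0 pXA tX]]|noX] := boolP [exists X, tight X].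
  have sXA := proper_sub pXA.
  pose N := \bigcup_(x in X) r x.
  have [||f1 inj1 f1r] := IH r X.
  - exact: leq_trans (proper_card pXA) leAm.
  - by move=> Y sYX; apply: hallA; apply: subset_trans sXA.
  have [||f2 inj2 f2r] := IH (fun x => r x :\: N) (A :\: X).
  - rewrite cardsD (setIidPr sXA); apply: leq_trans leAm.
    by rewrite ltn_subrL !card_gt0 X0; apply/set0Pn; exists x.
  - move=> Y; rewrite subsetD => /andP[sYA dYX].
    have -> : \bigcup_(y in Y) (r y :\: N) = (\bigcup_(y in Y :|: X) r y) :\: N.
      apply/setP=> u; rewrite inE; apply/bigcupP/andP => [[y yY]|[uN]].
        rewrite inE => /andP[uN ury]; split=> //.
        by apply/bigcupP; exists y; rewrite // inE yY.
      case/bigcupP=> y; rewrite inE => /orP[yY|yX] ury.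
        by exists y; rewrite // inE uN.
      by case/negP: uN; apply/bigcupP; exists y.
    have := hallA (Y :|: X); rewrite subUset sYA sXA => /(_ isT).
    rewrite cardsU (_ : Y :&: X = set0) ?cards0 ?subn0; last first.
      by apply/eqP; rewrite setI_eq0.
    rewrite cardsD => le1.
    have le2 := subset_leq_card (subsetIr (\bigcup_(y in Y :|: X) r y) N).
    by rewrite -(addnK #|X| #|Y|) leq_sub ?(leq_trans le2).
  have f1N z : z \in X -> f1 z \in N.
    by move=> zX; apply/bigcupP; exists z => //; exact: f1r.
  have f2N z : z \in A -> z \notin X -> (f2 z \notin N) && (f2 z \in r z).
    by move=> zA zX; have := f2r z; rewrite !inE zA zX => /(_ isT).
  exists (fun z => if z \in X then f1 z else f2 z) => [y z yA zA|z zA] /=.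
    case: ifPn => yX; case: ifPn => zX; first exact: inj1.
    - by move=> e; case/andP: (f2N _ zA zX); rewrite -e f1N.
    - by move=> e; case/andP: (f2N _ yA yX); rewrite e f1N.
    - by apply: inj2; rewrite inE ?yX ?zX.
  by case: ifPn => zX; [exact: f1r | case/andP: (f2N _ zA zX)].
have /card_gt0P[u ux] : 0 < #|r x|.
  by have := hallA [set x]; rewrite sub1set xA big_set1 cards1; apply.
have [||f injf fr] := IH (fun z => r z :\ u) (A :\ x).
- by move: leAm; rewrite (cardsD1 x A) xA.
- move=> Y; rewrite subsetD1 => /andP[sYA xY].
  have [->|Y0] := eqVneq Y set0; first by rewrite cards0.
  have -> : \bigcup_(y in Y) (r y :\ u) = (\bigcup_(y in Y) r y) :\ u.
    apply/setP=> v; rewrite !inE; apply/bigcupP/andP => [[y yY]|[vu]].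
      by rewrite !inE => /andP[vu vry]; split=> //; apply/bigcupP; exists y.
    by case/bigcupP=> y yY vry; exists y; rewrite // !inE vu.
  move/existsPn: noX => /(_ Y); rewrite /tight Y0 /= properE sYA /=.
  have -> /= : ~~ (A \subset Y) by apply: contra xY => /subsetP; apply.
  rewrite -ltnNge (cardsD1 u) => h.
  by rewrite -ltnS (leq_trans h) // -add1n leq_add2r leq_b1.
exists (fun z => if z == x then u else f z) => [y z yA zA|z zA] /=.
  have fu t : t \in A -> t != x -> f t != u.
    by move=> tA tx; have := fr t; rewrite !inE tA tx => /(_ isT) /andP[].
  case: eqVneq => [->|yx]; case: eqVneq => [->|zx] //.
  - by move=> e; have := fu _ zA zx; rewrite -e eqxx.
  - by move=> e; have := fu _ yA yx; rewrite e eqxx.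
  - by apply: injf; rewrite !inE ?yx ?zx.
by case: eqVneq => [->//|zx]; have := fr z; rewrite !inE zA zx => /(_ isT) /andP[].
Qed.

End Hall.

(** * Birkhoff's theorem *)

Section Birkhoff.
Import mathcomp.boot.fintype mathcomp.boot.finset.
Local Open Scope set_scope.

(** The common line sum [s] is a parameter, rather than 1, so that no division is
needed when the matrix of interest has line sums [x i j] or [1 - x i j], which
may vanish. *)
Definition bistochastic (R : realFieldType) (n : nat) (s : R) (M : 'M[R]_n) :=
  [/\ forall k l, 0 <= M k l,
      forall k, \sum_l M k l = s
    & forall l, \sum_k M k l = s].

(** Hall's condition holds for the graph of positive entries by double
counting: the rows in [X] carry total mass [s * #|X|], all of it in the
columns neighbouring [X], which cannot carry more than [s] each. *)
Lemma bistochastic_support_perm (R : realFieldType) (n : nat) (s : R) (M : 'M[R]_n) :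
  0 < s -> bistochastic s M -> exists sg : 'S_n, forall k, 0 < M k (sg k).
Proof.
case: n M => [|n] M s0 [M0 Mr Mc]; first by exists 1%g => -[].
pose r k := [set l | 0 < M k l].
have [X _|f injf fr] := hall_marriage ord0 (r := r) (A := [set: 'I_n.+1]).
  pose N := \bigcup_(k in X) r k.
  rewrite -(ler_nat R) -(ler_pM2l s0) !mulr_natr -!sumr_const.
  have -> : \sum_(k in X) s = \sum_(k in X) \sum_l M k l by apply: eq_bigr.
  have -> : \sum_(l in N) s = \sum_(l in N) \sum_k M k l by apply: eq_bigr.
  rewrite [leRHS]exchange_big /= [leRHS](bigID (mem X)) /=.
  rewrite -[leLHS]addr0 lerD ?sumr_ge0 // => [|k _]; last exact: sumr_ge0.
  apply: ler_sum => k kX; rewrite (bigID (mem N)) /= [X in _ + X]big1 ?addr0 // => l.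
  apply: contraNeq => Mkl; apply/bigcupP; exists k => //.
  by rewrite inE lt_def Mkl M0.
have injf' : injective f by move=> x y; apply: injf; rewrite inE.
by exists (perm injf') => k; have := fr k; rewrite permE !inE => /(_ isT).
Qed.

(** Birkhoff-von Neumann.  Subtracting from [M] the permutation matrix of a
permutation in its support, times the least entry [e] that it meets, keeps
the matrix bistochastic and kills at least one entry, so induction on the number
of nonzero entries applies.  The entry [M k l] is written as the total weight of
the permutations that pass through [(k, l)]. *)
Theorem birkhoff (R : realFieldType) (n : nat) (s : R) (M : 'M[R]_n) :
  bistochastic s M ->
  exists2 w : 'S_n -> R, (forall sg, 0 <= w sg)
    & forall k l, M k l = \sum_(sg : 'S_n | sg k == l) w sg.
Proof.
have [m] := ubnP #|[set p | M p.1 p.2 != 0]|.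
elim: m => // m IH in s M * => /ltnSE leMm bM; have [M0 Mr Mc] := bM.
have [MZ|] := boolP [forall k, forall l, M k l == 0].
  exists (fun=> 0) => // k l; rewrite big1 //.
  by apply/eqP; move/forallP: MZ => /(_ k)/forallP.
case/forallPn=> k0 /forallPn[l0 Mkl0].
have s0 : 0 < s.
  rewrite -(Mr k0) (bigD1 l0) //= ltr_wpDr ?sumr_ge0 //.
  by rewrite lt_def Mkl0 M0.
have [sg sgP] := bistochastic_support_perm s0 bM.
case: (@arg_minP _ R _ k0 xpredT (fun k => M k (sg k))) => // k1 _ mink1.
set e := M k1 (sg k1) in mink1.
pose M' := \matrix_(k, l) (M k l - (sg k == l)%:R * e).
have sumr k : \sum_l (sg k == l)%:R * e = e.
  rewrite (bigD1 (sg k)) //= eqxx mul1r big1 ?addr0 // => l.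
  by rewrite eq_sym => /negbTE->; rewrite mul0r.
have sumc l : \sum_k (sg k == l)%:R * e = e.
  rewrite (bigD1 ((sg^-1)%g l)) //= permKV eqxx mul1r big1 ?addr0 // => k.
  by rewrite -(can2_eq (permK sg) (permKV sg)) => /negbTE->; rewrite mul0r.
have [||w w0 wM] := IH (s - e) M'.
- apply: leq_trans leMm; apply: proper_card; apply/properP; split.
    apply/subsetP => -[k l]; rewrite !inE mxE /=; apply: contra => /eqP Mkl.
    have [E|_] := eqVneq (sg k) l; last by rewrite Mkl mul0r subr0.
    by have := sgP k; rewrite E Mkl ltxx.
  exists (k1, sg k1); rewrite !inE /=; first by rewrite gt_eqF // sgP.
  by rewrite mxE eqxx mul1r subrr eqxx.
- split=> [k l|k|l].
  + rewrite mxE; have [<-|_] := eqVneq (sg k) l; last by rewrite mul0r subr0.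
    by rewrite mul1r subr_ge0 mink1.
  + by under eq_bigr do rewrite mxE; rewrite sumrB Mr sumr.
  + by under eq_bigr do rewrite mxE; rewrite sumrB Mc sumc.
exists (fun t => w t + (t == sg)%:R * e) => [t|k l].
  by rewrite addr_ge0 ?mulr_ge0 // ltW // sgP.
rewrite big_split /= -wM mxE -mulr_suml.
suff -> : \sum_(t : 'S_n | t k == l) (t == sg)%:R = (sg k == l)%:R :> R.
  by rewrite subrK.
have [E|E] := boolP (sg k == l).
  by rewrite (bigD1 sg) //= eqxx big1 ?addr0 // => t /andP[_ /negbTE->].
by rewrite big1 // => t; case: (eqVneq t sg) => // ->; rewrite (negbTE E).
Qed.

(** A doubly substochastic matrix lies below a bistochastic one: the row defects
[a] and the column defects [b] have the same total [t], so the rank one matrix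
[a k * b l / t] fills both. *)
Lemma bistochastic_dominate (R : realFieldType) (n : nat) (s : R) (M : 'M[R]_n) :
    (forall k l, 0 <= M k l) -> (forall k, \sum_l M k l <= s) ->
    (forall l, \sum_k M k l <= s) ->
  exists2 N, bistochastic s N & forall k l, M k l <= N k l.
Proof.
move=> M0 Mr Mc.
pose a k := s - \sum_l M k l; pose b l := s - \sum_k M k l.
pose t := \sum_k a k.
have tb : t = \sum_l b l by rewrite /t /a /b !sumrB exchange_big.
have a0 k : 0 <= a k by rewrite subr_ge0.
have b0 l : 0 <= b l by rewrite subr_ge0.
have t0 : 0 <= t by apply: sumr_ge0.
have inc0 k l : 0 <= a k * b l / t by rewrite divr_ge0 ?mulr_ge0.
exists (\matrix_(k, l) (M k l + a k * b l / t)) => [|k l]; last first.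
  by rewrite mxE lerDl.
split=> [k l|k|l].
- by rewrite mxE addr_ge0.
- under eq_bigr do rewrite mxE.
  rewrite big_split /= -mulr_suml -mulr_sumr -tb.
  (* If [t = 0], all the defects vanish, and so does the division by [t]. *)
  have [t00|tn0] := eqVneq t 0; last by rewrite mulfK // addrC subrK.
  have ak : a k = 0.
    by apply: (psumr_eq0P (P := xpredT) _ t00).
  by rewrite ak !mul0r addr0; move/eqP: ak; rewrite subr_eq0 => /eqP.
- under eq_bigr do rewrite mxE.
  rewrite big_split /= -mulr_suml -mulr_suml -/t mulrAC.
  have [t00|tn0] := eqVneq t 0; last by rewrite divff // mul1r addrC subrK.
  have bl : b l = 0.
    by move: t00; rewrite tb => t00; apply: (psumr_eq0P (P := xpredT) _ t00).
  by rewrite bl mulr0 addr0; move/eqP: bl; rewrite subr_eq0 => /eqP.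
Qed.

End Birkhoff.

(** * Minors with constant line sums *)

Definition minor_mx (n : nat) (i j : 'I_n) (sg : 'S_n) : 'M[bool]_n :=
  \matrix_(k, l) [&& k != i, l != j & sg k == l].

Lemma minor_mx_perm (n : nat) (i j : 'I_n) (sg : 'S_n) :
  sg i = j -> minor_mx i j sg \in minor_perm i j.
Proof.
move=> sgi; rewrite inE; apply/and3P; split.
- apply/forallP => k; apply/forallP => l; apply/implyP.
  by rewrite mxE => /orP[]/eqP->; rewrite eqxx ?andbF.
- apply/forallP => k; apply/implyP => ki.
  have skj : sg k != j by rewrite -sgi (inj_eq perm_inj).
  rewrite (bigD1 (sg k)) //= mxE ki skj eqxx big1 // => l /andP[lj lsk].
  by rewrite mxE [sg k == l]eq_sym (negbTE lsk) !andbF.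
- apply/forallP => l; apply/implyP => lj.
  have sli : (sg^-1)%g l != i.
    by apply: contra lj => /eqP e; rewrite -sgi -e permKV.
  rewrite (bigD1 ((sg^-1)%g l)) //= mxE lj sli permKV eqxx big1 // => k /andP[ki].
  by rewrite mxE -(can2_eq (permK sg) (permKV sg)) => /negbTE->; rewrite !andbF.
Qed.

Definition minor_bistochastic (R : realFieldType) (n : nat) (i j : 'I_n) (s : R)
    (M : 'M[R]_n) :=
  [/\ forall k l, k != i -> l != j -> 0 <= M k l,
      forall k, k != i -> \sum_(l | l != j) M k l = s
    & forall l, l != j -> \sum_(k | k != i) M k l = s].

(** The minor of [M] that omits row [i] and column [j], completed to a square
matrix of full size by putting its line sum [s] at the corner [(i, j)], so that
Birkhoff's theorem for full matrices yields it for minors. *)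
Definition pad (R : realFieldType) (n : nat) (i j : 'I_n) (s : R) (M : 'M[R]_n) :
    'M[R]_n :=
  \matrix_(k, l) if k == i then (if l == j then s else 0)
                 else if l == j then 0 else M k l.

Lemma pad_row (R : realFieldType) (n : nat) (i j : 'I_n) (s : R) (M : 'M[R]_n) k :
  \sum_l pad i j s M k l = if k == i then s else \sum_(l | l != j) M k l.
Proof.
rewrite (bigD1 j) //= mxE eqxx; case: eqP => ki.
  rewrite big1 ?addr0 // => l lj.
  by rewrite mxE ki eqxx (negbTE lj).
rewrite add0r; apply: eq_bigr => l lj.
by rewrite mxE (negbTE lj); case: eqP.
Qed.

Lemma pad_col (R : realFieldType) (n : nat) (i j : 'I_n) (s : R) (M : 'M[R]_n) l :
  \sum_k pad i j s M k l = if l == j then s else \sum_(k | k != i) M k l.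
Proof.
rewrite (bigD1 i) //= mxE eqxx; case: eqP => lj.
  rewrite big1 ?addr0 // => k ki.
  by rewrite mxE lj eqxx (negbTE ki).
rewrite add0r; apply: eq_bigr => k ki.
by rewrite mxE (negbTE ki); case: eqP.
Qed.

Lemma pad_ge0 (R : realFieldType) (n : nat) (i j : 'I_n) (s : R) (M : 'M[R]_n) :
  0 <= s -> (forall k l, k != i -> l != j -> 0 <= M k l) ->
  forall k l, 0 <= pad i j s M k l.
Proof.
move=> s0 M0 k l; rewrite mxE.
by case: eqVneq => ?; case: eqVneq => ? //; exact: M0.
Qed.

Lemma padE (R : realFieldType) (n : nat) (i j : 'I_n) (s : R) (M : 'M[R]_n) k l :
  k != i -> l != j -> pad i j s M k l = M k l.
Proof. by move=> ki lj; rewrite mxE (negbTE ki) (negbTE lj). Qed.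

Lemma bistochastic_corner (R : realFieldType) (n : nat) (i j : 'I_n) (s : R)
    (N : 'M[R]_n) :
  bistochastic s N -> s <= N i j -> N i j = s /\ forall l, l != j -> N i l = 0.
Proof.
move=> [N0 Nr _] sN.
have NiE : N i j + \sum_(l | l != j) N i l = s by rewrite -(Nr i) [RHS](bigD1 j).
have rest0 : \sum_(l | l != j) N i l = 0.
  apply/eqP; rewrite eq_le sumr_ge0 // andbT.
  by rewrite -(lerD2l (N i j)) NiE addr0.
by split=> [|l lj]; [rewrite -NiE rest0 addr0 | apply: (psumr_eq0P _ rest0)].
Qed.

(** When the corner [(i, j)] carries the whole mass of row [i], every
permutation of positive weight passes through it, and hence restricts to a
permutation of the minor. *)
Lemma birkhoff_corner (R : realFieldType) (n : nat) (i j : 'I_n) (s : R)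
    (N : 'M[R]_n) :
  bistochastic s N -> s <= N i j ->
  exists w : 'S_n -> R, [/\ forall sg, 0 <= w sg,
    \sum_(sg : 'S_n | sg i == j) w sg = s
  & forall k l, k != i -> l != j ->
      N k l = \sum_(sg : 'S_n | sg i == j) w sg * (minor_mx i j sg k l)%:R].
Proof.
move=> bN sN; have [Nij Ni0] := bistochastic_corner bN sN.
have [w w0 wN] := birkhoff bN; exists w; split=> // [|k l ki lj].
  by rewrite -wN.
have wout (sg : 'S_n) : sg i != j -> w sg = 0.
  move=> sgi; apply/eqP; rewrite eq_le w0 andbT -(Ni0 _ sgi) wN.
  by rewrite (bigD1 sg) //= lerDl sumr_ge0.
rewrite wN big_mkcond [RHS]big_mkcond; apply: eq_bigr => sg _.
rewrite mxE ki lj /=; have [//|/wout->] := boolP (sg i == j).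
  by case: ifP; rewrite ?mulr1 ?mulr0.
by case: ifP.
Qed.

(** * Bounds on the cost of a minor *)

Section Cost.
Variables (R : realType) (n : nat) (D P : 'M[R]_n) (i j : 'I_n).

Lemma minor_cost_sum (w : 'S_n -> R) (N : 'M[R]_n) :
    (forall k l, k != i -> l != j ->
      N k l = \sum_(sg : 'S_n | sg i == j) w sg * (minor_mx i j sg k l)%:R) ->
  minor_cost D P i j N =
  \sum_(sg : 'S_n | sg i == j) w sg * perm_cost D P i j (minor_mx i j sg).
Proof.
move=> wN; rewrite /minor_cost; under [RHS]eq_bigr do rewrite mulr_sumr.
rewrite [RHS]exchange_big; apply: eq_bigr => k ki /=.
under [RHS]eq_bigr do rewrite mulr_sumr.
rewrite [RHS]exchange_big; apply: eq_bigr => l lj /=.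
rewrite wN // mulr_sumr; apply: eq_bigr => sg _.
by rewrite [in RHS]mxE mulrCA.
Qed.

Lemma mem_perm_costs x : x \in minor_perm i j ->
  perm_cost D P i j x \in perm_costs D P i j.
Proof. exact: fintype.image_f. Qed.

Lemma l_bound_le_perm_cost x : x \in minor_perm i j ->
  l_bound D P i j <= perm_cost D P i j x.
Proof.
by move=> /mem_perm_costs xin; exact: (@ge_bigmin_seq _ _ _ _ _ _ xpredT id).
Qed.

Lemma perm_cost_le_u_bound x : x \in minor_perm i j ->
  perm_cost D P i j x <= u_bound D P i j.
Proof.
by move=> /mem_perm_costs xin; exact: (@le_bigmax_seq _ _ _ _ _ _ xpredT id).
Qed.

(** The weights are kept together with the costs because the case of equality
needs both: the cost tells which weights vanish, and the weights determine the
entries. *)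
Lemma minor_cost_decomposition (s : R) (M : 'M[R]_n) :
  0 <= s -> minor_bistochastic i j s M ->
  exists w : 'S_n -> R, [/\ forall sg, 0 <= w sg,
    \sum_(sg : 'S_n | sg i == j) w sg = s,
    forall k l, k != i -> l != j ->
      M k l = \sum_(sg : 'S_n | sg i == j) w sg * (minor_mx i j sg k l)%:R
  & minor_cost D P i j M =
    \sum_(sg : 'S_n | sg i == j) w sg * perm_cost D P i j (minor_mx i j sg)].
Proof.
move=> s0 [M0 Mr Mc].
have bM : bistochastic s (pad i j s M).
  split=> [|k|l]; first exact: pad_ge0.
  - by rewrite pad_row; case: eqVneq => // ?; rewrite Mr.
  - by rewrite pad_col; case: eqVneq => // ?; rewrite Mc.
have [|w [w0 ws wM]] := @birkhoff_corner _ _ i j _ _ bM; first by rewrite mxE !eqxx.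
have wM' k l : k != i -> l != j ->
    M k l = \sum_(sg : 'S_n | sg i == j) w sg * (minor_mx i j sg k l)%:R.
  by move=> ki lj; rewrite -wM // padE.
by exists w; split=> //; exact: minor_cost_sum.
Qed.

Lemma l_bound_le_minor_cost (s : R) (M : 'M[R]_n) :
  0 <= s -> minor_bistochastic i j s M ->
  l_bound D P i j * s <= minor_cost D P i j M.
Proof.
move=> s0 /(minor_cost_decomposition s0)[w [w0 <- _ ->]].
rewrite mulr_sumr; apply: ler_sum => sg /eqP/minor_mx_perm sgP.
by rewrite mulrC ler_wpM2l // l_bound_le_perm_cost.
Qed.

(** If the cost attains its lower bound, every permutation of positive weight
is a minimizer, so an entry on which all minimizers agree has its value forced.
The two assumptions of the theorem are the cases [e = true] and
[e = false]. *)
Lemma minor_cost_tight (s : R) (M : 'M[R]_n) (e : bool) (k l : 'I_n) :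
    0 <= s -> minor_bistochastic i j s M ->
    minor_cost D P i j M = l_bound D P i j * s ->
    k != i -> l != j ->
    (forall x, x \in argmin_l D P i j -> x k l = e) ->
  M k l = e%:R * s.
Proof.
move=> s0 /(minor_cost_decomposition s0)[w [w0 <- wM ->]] + ki lj argE.
move/eqP; rewrite mulr_sumr -subr_eq0 -sumrB => /eqP gap0.
rewrite wM // mulr_sumr; apply: eq_bigr => sg sgi.
rewrite mulrC; have [->|wn0] := eqVneq (w sg) 0; first by rewrite !mulr0.
rewrite argE // inE; have sgP := minor_mx_perm (eqP sgi); rewrite sgP /=.
move: gap0 => /psumr_eq0P -/(_ _ sg sgi) gap.
have /eqP : w sg * perm_cost D P i j (minor_mx i j sg) - l_bound D P i j * w sg = 0.
  apply: gap => t /eqP/minor_mx_perm tP.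
  by rewrite subr_ge0 mulrC ler_wpM2l // l_bound_le_perm_cost.
by rewrite mulrC -mulrBl mulf_eq0 (negbTE wn0) orbF subr_eq0.
Qed.

Lemma minor_costB (M N : 'M[R]_n) :
  minor_cost D P i j (M - N) = minor_cost D P i j M - minor_cost D P i j N.
Proof.
rewrite -sumrB; apply: eq_bigr => k _; rewrite -sumrB; apply: eq_bigr => l _.
by rewrite !mxE mulrBr.
Qed.

Hypothesis coef_ge0 : forall k l, k != i -> l != j -> 0 <= P i k * D j l.

Lemma minor_cost_le (M N : 'M[R]_n) :
    (forall k l, k != i -> l != j -> M k l <= N k l) ->
  minor_cost D P i j M <= minor_cost D P i j N.
Proof.
move=> MN; apply: ler_sum => k ki; apply: ler_sum => l lj.
by rewrite ler_wpM2l ?coef_ge0 ?MN.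
Qed.

Lemma l_bound_ge0 : 0 <= l_bound D P i j.
Proof.
have cost0 v : v \in perm_costs D P i j -> 0 <= v.
  case/fintype.imageP => x _ ->; apply: sumr_ge0 => k ki; apply: sumr_ge0 => l lj.
  by rewrite mxE mulr_ge0 ?coef_ge0 ?ler0n.
rewrite /l_bound big_seq; apply: le_bigmin => [|v]; last exact: cost0.
by case: (perm_costs D P i j) cost0 => //= v s; apply; rewrite mem_head.
Qed.

(** Since the coefficients are nonnegative, the line sums need only be at most
[s]: passing to a dominating bistochastic matrix does not lower the cost. *)
Lemma minor_cost_le_u_bound (s : R) (M : 'M[R]_n) :
    0 <= s -> (forall k l, k != i -> l != j -> 0 <= M k l) ->
    (forall k, k != i -> \sum_(l | l != j) M k l <= s) ->
    (forall l, l != j -> \sum_(k | k != i) M k l <= s) ->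
  minor_cost D P i j M <= u_bound D P i j * s.
Proof.
move=> s0 M0 Mr Mc.
have [|k|l|N bN MN] := @bistochastic_dominate _ _ s (pad i j s M).
- exact: pad_ge0.
- by rewrite pad_row; case: eqVneq => // ?; rewrite Mr.
- by rewrite pad_col; case: eqVneq => // ?; rewrite Mc.
have [|w [w0 ws wN]] := @birkhoff_corner _ _ i j _ _ bN.
  by have := MN i j; rewrite mxE !eqxx.
apply: (@le_trans _ _ (minor_cost D P i j N)).
  by apply: minor_cost_le => k l ki lj; rewrite -(padE s M ki lj).
rewrite (minor_cost_sum wN) -ws mulr_sumr.
apply: ler_sum => sg /eqP/minor_mx_perm sgP.
by rewrite mulrC ler_wpM2r // perm_cost_le_u_bound.
Qed.

End Cost.

(** * The projection satisfies the Xia-Yuan inequalities *)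

Section ProjectionIncluded.
Variables (R : realType) (n : nat) (x : 'M[R]_n).
Variable y : 'I_n -> 'I_n -> 'I_n -> 'I_n -> R.

(** By the symmetry of [y], the slice [y i j] has the line sums prescribed by the
assignment constraints on the first two indices of [y k l i j], all equal to
[x i j]. *)
Lemma LAJ_minor i j : LAJ (x, y) ->
  minor_bistochastic i j (x i j) (\matrix_(k, l) y i j k l).
Proof.
move=> [_ yr yc ys]; split=> [k l ki lj|k ki|l lj].
- by rewrite mxE; case: (ys _ _ _ _ ki lj).
- rewrite -(yc k i j ki); apply: eq_bigr => l lj.
  by rewrite mxE; case: (ys _ _ _ _ ki lj).
- rewrite -(yr l i j lj); apply: eq_bigr => k ki.
  by rewrite mxE; case: (ys _ _ _ _ ki lj).
Qed.

Lemma LAJ_le i j k l : LAJ (x, y) -> k != i -> l != j -> y i j k l <= x k l.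
Proof.
move=> [_ yr _ ys] ki lj; rewrite -(yr j k l) 1?eq_sym // (bigD1 i) 1?eq_sym //=.
rewrite lerDl sumr_ge0 // => i' /andP[i'k _].
by have [||_ ->] := ys i' j k l => //; rewrite eq_sym.
Qed.

(** The slice [Y] of [y] at [(i, j)] has line sums [x i j], which gives the first
inequality.  The remainder [x - Y] is nonnegative with line sums at most
[1 - x i j], because the line sums of [x] over the minor are at most 1; this
gives the second. *)
Lemma LAJ_plus_sub_LXY (D P : 'M[R]_n) (z : 'M[R]_n) :
    (forall i j k l : 'I_n, k != i -> l != j -> 0 <= P i k * D j l) ->
  LAJ_plus D P (x, y, z) -> LXY D P (x, z).
Proof.
move=> coef_ge0 [Lxy zE]; have [[x0 xc xr] _ _ _] := Lxy.
split=> // i j; have yij := LAJ_minor i j Lxy.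
split; rewrite zE; first exact: l_bound_le_minor_cost.
have [_ yr yc] := yij.
suff : minor_cost D P i j (x - \matrix_(k, l) y i j k l) <=
       u_bound D P i j * (1 - x i j).
  by rewrite minor_costB -(opprB (x i j)) mulrN lerBlDl lerBrDr.
have row_le k : \sum_(l | l != j) x k l <= 1.
  by rewrite -(xr k) [leRHS](bigD1 j) //= lerDr.
have col_le l : \sum_(k | k != i) x k l <= 1.
  by rewrite -(xc l) [leRHS](bigD1 i) //= lerDr.
set Y := \matrix_(k, l) y i j k l in yr yc *.
have subE k l : (x - Y) k l = x k l - Y k l by rewrite mxE [(- Y) k l]mxE.
apply: minor_cost_le_u_bound => [k l|||k ki|l lj].
- exact: coef_ge0.
- by rewrite subr_ge0 -(xr i) (bigD1 j) //= lerDl sumr_ge0.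
- by move=> k l ki lj; rewrite !mxE subr_ge0; exact: LAJ_le.
- under eq_bigr do rewrite subE.
  by rewrite sumrB yr // lerB.
- under eq_bigr do rewrite subE.
  by rewrite sumrB yc // lerB.
Qed.

End ProjectionIncluded.

(** * A point outside the projection *)

(** Uniform entries make [x a b] and [x c d] positive for every choice of
indices, and [z] on its first lower bound forces each slice of a preimage [y] to
have minimal cost. *)
Definition flat_point (R : realType) (n : nat) (D P : 'M[R]_n) : 'M[R]_n * 'M[R]_n :=
  (const_mx n%:R^-1, \matrix_(i, j) (l_bound D P i j * n%:R^-1)).

(** The uniform matrix has line sums [1 - n^-1] over each minor, so its cost there
is at most [u_bound i j * (1 - n^-1)].  Hence the second lower bound on [z i j]
is nonpositive, while [l_bound i j] is nonnegative. *)
Lemma flat_point_LXY (R : realType) (n : nat) (D P : 'M[R]_n) :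
    (forall i j k l : 'I_n, k != i -> l != j -> 0 <= P i k * D j l) ->
  LXY D P (flat_point D P).
Proof.
move=> coef_ge0.
have nn : forall i : 'I_n, \sum_(j < n) n%:R^-1 = 1 :> R.
  move=> i; rewrite sumr_const card_ord -[LHS]mulr_natr mulVf // pnatr_eq0.
  by rewrite -lt0n (leq_trans _ (ltn_ord i)).
have inv0 : 0 <= n%:R^-1 :> R by rewrite invr_ge0 ler0n.
split.
  split=> [i j|j|i]; first by rewrite mxE.
    by under eq_bigr do rewrite mxE; exact: nn.
  by under eq_bigr do rewrite mxE; exact: nn.
move=> i j; rewrite !mxE; split=> //.
have sumD1 k0 : \sum_(l < n | l != k0) n%:R^-1 = 1 - n%:R^-1 :> R.
  by apply: (canRL (addrK _)); rewrite -[RHS](nn k0) [RHS](bigD1 k0) //= addrC.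
have : minor_cost D P i j (const_mx n%:R^-1) <= u_bound D P i j * (1 - n%:R^-1).
  apply: minor_cost_le_u_bound => [k l||k l _ _|k _|l _].
  - exact: coef_ge0.
  - by rewrite -(sumD1 i) sumr_ge0.
  - by rewrite mxE.
  - by under eq_bigr do rewrite mxE; rewrite sumD1.
  - by under eq_bigr do rewrite mxE; rewrite sumD1.
have : 0 <= l_bound D P i j * n%:R^-1.
  by rewrite mulr_ge0 // l_bound_ge0 // => k l; exact: coef_ge0.
by move=> l0 cu; rewrite (le_trans _ l0) // -(opprB 1) mulrN subr_le0.
Qed.

(** The slices of [y] at [(a, b)] and at [(c, d)] would both have minimal cost,
so the first would give [y a b c d = x a b > 0] and the second
[y c d a b = 0], against the symmetry of [y]. *)
Lemma flat_point_notin_proj (R : realType) (n : nat) (D P : 'M[R]_n) (a b c d : 'I_n) :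
    a != c -> b != d ->
    (forall x, x \in argmin_l D P a b -> x c d = true) ->
    (forall x, x \in argmin_l D P c d -> x a b = false) ->
  ~ proj_xz (LAJ_plus D P) (flat_point D P).
Proof.
move=> ac bd ab1 cd0 [y [/= Lxy zE]]; have [[x0 _ _] _ _ ys] := Lxy.
have tight i j : minor_cost D P i j (\matrix_(k, l) y i j k l) =
    l_bound D P i j * (const_mx n%:R^-1 : 'M[R]_n) i j.
  by rewrite -zE !mxE.
have y1 := minor_cost_tight (x0 a b) (LAJ_minor a b Lxy) (tight a b).
have y0 := minor_cost_tight (x0 c d) (LAJ_minor c d Lxy) (tight c d).
have [||yabcd _] := ys a b c d; rewrite 1?eq_sym //.
have y_eq1 : y a b c d = n%:R^-1.
  by have := y1 true c d; rewrite !mxE mul1r; apply; rewrite 1?eq_sym.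
have y_eq0 : y c d a b = 0.
  by have := y0 false a b; rewrite !mxE mul0r; apply.
move: y_eq1; rewrite yabcd y_eq0 => /esym/eqP.
rewrite invr_eq0 pnatr_eq0 -leqn0 leqNgt.
by rewrite (leq_ltn_trans (leq0n a) (ltn_ord a)).
Qed.

Unset Implicit Arguments.

Theorem theorem2 (R : realType) (n : nat) (D P : 'M[R]_n)
    (coef_ge0 : forall i j k l : 'I_n,
       k != i -> l != j -> 0 <= P i k * D j l)
    (habcd : exists a b c d : 'I_n,
       [/\ a != c, b != d,
           forall x, x \in argmin_l D P a b -> x c d = true
         & forall x, x \in argmin_l D P c d -> x a b = false]) :
  proj_xz (LAJ_plus D P) `<` LXY D P.
Proof.
case: habcd => a [b [c [d [ac bd ab1 cd0]]]]; split.
  by case=> x z [y]; exact: LAJ_plus_sub_LXY.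
move=> sub; apply: (flat_point_notin_proj ac bd ab1 cd0).
by apply: sub; exact: flat_point_LXY.
Qed.
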